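(* Let $H$ be a real separable Hilbert space, let $T>0$, and let $A,B:H\to H$ be linear, bounded and symmetric operators such that, for some constant $\beta>0$, $$\langle Ax,x\rangle\ge \beta\|x\|^2\quad\text{and}\quad \langle Bx,x\rangle\ge 0\qquad\text{for all }x\in H.$$ For every $t\in[0,T]$ let $C(t)\subset H$ be a nonempty closed convex set, and suppose that there exists a nondecreasing absolutely continuous function $v:[0,T]\to[0,+\infty)$ with $v(0)=0$ such that $$d_H(C(t),C(s))\le v(t)-v(s)\qquad\text{for all }0\le s\le t\le T.$$ Then for any $u_0\in H$ with $Bu_0\in C(0)$, there exists a unique Lipschitz continuous mapping $u:[0,T]\to H$ satisfying $$-\dot u(t)\in \mathrm{N}_{C(t)}\big(A\dot u(t)+Bu(t)\big)\quad\text{for a.e. }t\in[0,T],\qquad u(0)=u_0.$$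
   Context: $\langle\cdot,\cdot\rangle$ and $\|\cdot\|$ denote the inner product and norm of $H$, and $\dot u$ is the time derivative of $u$. For a nonempty closed convex set $C\subset H$ and $x\in C$, the normal cone is $\mathrm{N}_C(x)=\{x^*\in H:\langle x^*,y-x\rangle\le 0\ \text{for all }y\in C\}$, and $\mathrm{N}_C(x)=\emptyset$ if $x\notin C$; in particular the inclusion contains the requirement $A\dot u(t)+Bu(t)\in C(t)$ for a.e. $t$. With $d_C(x)=\inf_{y\in C}\|x-y\|$, the Hausdorff distance between two subsets $C_1,C_2$ of $H$ is $d_H(C_1,C_2)=\max\{\sup_{x\in C_2}d_{C_1}(x),\ \sup_{x\in C_1}d_{C_2}(x)\}$. *)

(* Defs.v *)
From HB Require Import structures.
From mathcomp Require Import all_boot all_order all_algebra sesquilinear.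
From mathcomp Require Import all_classical all_reals all_analysis.

Set Implicit Arguments.
Unset Strict Implicit.
Unset Printing Implicit Defensive.

Import Order.TTheory GRing.Theory Num.Theory.
Import numFieldNormedType.Exports.

Local Open Scope classical_set_scope.
Local Open Scope ring_scope.

Definition separable_space (X : topologicalType) : Prop :=
  exists2 D : set X, countable D & dense D.

Definition bounded_operator (R : realType) (H : normedModType R)
    (A : H -> H) : Prop :=
  exists M : R, forall x : H, `|A x| <= M * `|x|.

Definition symmetric_operator (R : realType) (H : normedModType R)
    (ip : {dot H for (@idfun R)}) (A : H -> H) : Prop :=
  forall x y : H, ip (A x) y = ip x (A y).

(* The clause [C x] makes the cone empty when [x] is not in [C]. *)
Definition normal_cone (R : realType) (H : normedModType R)
    (ip : {dot H for (@idfun R)}) (C : set H) (x : H) : set H :=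
  [set p | C x /\ forall y, C y -> ip p (y - x) <= 0].

(* Extended-real valued: the Hausdorff distance of unbounded sets may be
   infinite. *)
Definition set_dist (R : realType) (H : normedModType R) (C : set H) (x : H)
    : \bar R :=
  ereal_inf [set (`|x - y|)%:E | y in C].

Definition hausdorff_dist (R : realType) (H : normedModType R)
    (C1 C2 : set H) : \bar R :=
  maxe (ereal_sup [set set_dist C1 x | x in C2])
       (ereal_sup [set set_dist C2 x | x in C1]).

(* Finite families of nonoverlapping subintervals of [a, b]. *)
Definition absolutely_continuous (R : realType) (a b : R) (f : R -> R) : Prop :=
  forall e : R, 0 < e -> exists2 d : R, 0 < d &
    forall (n : nat) (s t : 'I_n -> R),
      (forall i, a <= s i /\ s i <= t i /\ t i <= b) ->
      trivIset [set: 'I_n] (fun i => `]s i, t i[%classic) ->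
      \sum_(i < n) (t i - s i) < d ->
      \sum_(i < n) `|f (t i) - f (s i)| < e.

(* Only the values of [u] on [0, T] matter: [derivable] looks outside [0, T]
   only at the two endpoints, which form a null set. *)
Definition sweeping_solution (R : realType) (H : normedModType R)
    (ip : {dot H for (@idfun R)}) (T : R) (A B : H -> H) (C : R -> set H)
    (u0 : H) (u : R -> H) : Prop :=
  [/\ [lipschitz u t | t in `[0, T]],
      {ae (@lebesgue_measure R), forall t : R, t \in `[0, T] ->
         derivable u t 1 /\
         normal_cone ip (C t) (A (derive1 u t) + B (u t)) (- derive1 u t)} &
      u 0 = u0].

(* Main.v *)
(* At time t and state u the inclusion prescribes the velocity: it is the y with
   A y + B u in C(t) and <y, c - (A y + B u)> >= 0 for all c in C(t), that is,
   the minimiser of <A y, y> over the closed convex set of those y for which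
   A y + B u lies in C(t). Coercivity of A makes it Lipschitz in u, uniformly in
   t, and 1/2-Hoelder in t with respect to v. The inclusion is thus an ordinary
   differential equation u' = F(t, u), with F continuous in t and Lipschitz in
   u; Picard iteration gives a solution for which it holds at every t.

   If u and w are Lipschitz solutions, then |w - u| exp(-L t) grows at most
   linearly and has nonpositive upper right derivative almost everywhere, so it
   is nonincreasing. *)
Require Import Defs.
From HB Require Import structures.
From mathcomp Require Import all_boot all_order all_algebra sesquilinear.
From mathcomp Require Import all_classical all_reals all_analysis.
From mathcomp Require Import lra.

Set Implicit Arguments.
Unset Strict Implicit.

Import Order.TTheory GRing.Theory Num.Theory.
Import numFieldNormedType.Exports.
Local Open Scope classical_set_scope.
Local Open Scope ring_scope.

(** * Inner product identities and the Cauchy-Schwarz inequality *)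

Section inner_product.
Context (R : realType) (H : normedModType R) (ip : {dot H for (@idfun R)}).
Hypothesis ip_norm : forall x : H, ip x x = `|x| ^+ 2.

Lemma ipC x y : ip x y = ip y x.
Proof. by have := hermC ip x y; rewrite expr0 mul1r. Qed.

Lemma ipDl x y z : ip (x + y) z = ip x z + ip y z.
Proof. exact: linearDl. Qed.

Lemma ipZl a x z : ip (a *: x) z = a * ip x z.
Proof. exact: linearZl_LR. Qed.

Lemma ipNl x z : ip (- x) z = - ip x z.
Proof. exact: linearNl. Qed.

Lemma ipBl x y z : ip (x - y) z = ip x z - ip y z.
Proof. exact: linearBl. Qed.

Lemma ipDr x y z : ip z (x + y) = ip z x + ip z y.
Proof. by rewrite ipC ipDl !(ipC z). Qed.

Lemma ipZr a x z : ip z (a *: x) = a * ip z x.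
Proof. by rewrite ipC ipZl (ipC z). Qed.

Lemma ipNr x z : ip z (- x) = - ip z x.
Proof. by rewrite ipC ipNl (ipC z). Qed.

Lemma ipBr x y z : ip z (x - y) = ip z x - ip z y.
Proof. by rewrite ipDr ipNr. Qed.

(** Expanding the square of the norm of [|y| x - |x| y] gives [2 |x| |y|] times the difference of
    the two sides; the cases [x = 0] and [y = 0] are split off so that this factor can be
    cancelled. *)
Lemma cauchy_schwarz x y : ip x y <= `|x| * `|y|.
Proof.
have [->|x0] := eqVneq x 0; first
  by rewrite -(scale0r 0) ipZl normrZ normr0 !mul0r.
have [->|y0] := eqVneq y 0; first
  by rewrite -(scale0r 0) ipZr normrZ normr0 !mul0r mulr0.
have nx : 0 < `|x| by rewrite normr_gt0.
have ny : 0 < `|y| by rewrite normr_gt0.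
have : 0 <= `| (`|y| *: x - `|x| *: y) | ^+ 2 by exact: sqr_ge0.
rewrite -ip_norm !(ipBl, ipBr, ipZl, ipZr) !ip_norm (ipC y x) => h.
have p : 0 < `|x| * `|y| by rewrite mulr_gt0.
by rewrite -(ler_pM2l p); nra.
Qed.

Lemma normr_ip x y : `|ip x y| <= `|x| * `|y|.
Proof.
rewrite ler_norml cauchy_schwarz andbT lerNl -ipNr -(normrN y).
exact: cauchy_schwarz.
Qed.

End inner_product.

(** * Geometric error bounds *)

Lemma le_geometric (R : realType) (x y K : R) :
  (forall n, x <= y + K / 2 ^+ n) -> x <= y.
Proof.
(* Taking [n] above [|K| / e] suffices, because [n < 2 ^ n]. *)
move=> h; apply/ler_addgt0Pr => e e0; 
apply: le_trans (h (Num.trunc (`|K| / e)).+1) _; rewrite lerD2l.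
rewrite ler_pdivrMr ?exprn_gt0// -ler_pdivrMl// mulrC.
have Ke : K / e <= `|K| / e by rewrite ler_wpM2r ?invr_ge0 ?ler_norm// ltW.
apply: le_trans Ke (le_trans (ltW (truncnS_gt _)) _).
by rewrite -natrX ler_nat ltnW// ltn_expl.
Qed.

Lemma geometric_lt (R : realType) (K e : R) : 0 < e ->
  exists n, K / 2 ^+ n < e.
Proof.
move=> e0; apply: contrapT => /forallNP h.
have : e <= 0.
  by apply: (@le_geometric _ _ _ K) => n; rewrite add0r leNgt; exact/negP.
by rewrite leNgt e0.
Qed.

(** The explicit rate matters: both the minimising sequence and the Picard iterates pass to the
    limit through it. *)
Lemma geometric_cvg (R : realType) (V : completeNormedModType R) (x : V ^nat)
    (K : R) :
  (forall n, `|x n.+1 - x n| <= K / 2 ^+ n) ->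
  exists l, forall n, `|l - x n| <= 2 * K / 2 ^+ n.
Proof.
move=> hx.
(* Subtracting the tail closes the induction on [k]: each step costs [K / 2 ^ (n + k)], exactly the
   decrease of the tail. *)
have hk n k : `|x (n + k)%N - x n| <= 2 * K / 2 ^+ n - 2 * K / 2 ^+ (n + k).
  elim: k => [|k IH]; first by rewrite addn0 !subrr normr0.
  rewrite addnS -(subrKA (x (n + k)%N)); apply: le_trans (ler_normD _ _) _.
  apply: le_trans (lerD (hx _) IH) _.
  suff -> : 2 * K / 2 ^+ (n + k).+1 = K / 2 ^+ (n + k) by lra.
  by rewrite exprS -mulf_div divff ?mul1r.
have K0 : 0 <= K by have := hx 0%N; rewrite expr0 divr1; apply: le_trans.
have hK n m : (n <= m)%N -> `|x m - x n| <= 2 * K / 2 ^+ n.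
  move=> /subnKC <-; apply: le_trans (hk _ _) _.
  by rewrite gerBl divr_ge0 ?exprn_ge0// mulr_ge0.
have cx : cvgn x.
  apply/cauchy_cvgP/cauchy_exP => e e0.
  have [N hN] := @geometric_lt _ (2 * K) _ e0.
  exists (x N), N => // n /= Nn; rewrite -ball_normE /ball_/= distrC.
  exact: le_lt_trans (hK _ _ Nn) hN.
exists (limn x) => n.
apply/ler_addgt0Pr => e e0.
have /cvgrPdist_le/(_ _ e0) [N _ hN] := cx.
rewrite -(subrKA (x (maxn n N))) [leRHS]addrC;
  apply: le_trans (ler_normD _ _) _.
by apply: lerD; [apply: hN; exact: leq_maxr | apply: hK; exact: leq_maxl].
Qed.

(** * Symmetric variational inequalities *)

Section variational_inequality.
Context (R : realType) (H : completeNormedModType R).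
Context (ip : {dot H for (@idfun R)}).
Hypothesis ip_norm : forall x : H, ip x x = `|x| ^+ 2.
Context (A : {linear H -> H}) (beta : R).
Hypotheses (beta_gt0 : 0 < beta) (A_bounded : bounded_operator A)
  (A_symmetric : symmetric_operator ip A)
  (A_coercive : forall x : H, beta * `|x| ^+ 2 <= ip (A x) x).

Lemma bounded_operator_ge0 (B : H -> H) : bounded_operator B ->
  exists2 M, 0 <= M & forall x, `|B x| <= M * `|x|.
Proof.
move=> [M hM]; exists (Num.max M 0); first by rewrite le_max lexx orbT.
by move=> x; apply: le_trans (hM x) _; rewrite ler_wpM2r// le_max lexx.
Qed.

(** Since [A] is symmetric, this is the first-order condition, along segments from [y] to [c], for a
    minimiser of [J x = <A x, x> - 2 l x] on [K]. Coercivity makes a minimising sequence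
    converge. *)
Lemma symmetric_stampacchia (l : H -> R) (K : set H) :
  (forall a x y, l (a *: x + y) = a * l x + l y) ->
  (exists M, forall x, `|l x| <= M * `|x|) ->
  closed K -> K !=set0 ->
  (forall a x y, 0 <= a -> a <= 1 -> K x -> K y -> K (x + a *: (y - x))) ->
  exists2 y, K y & forall c, K c -> l (c - y) <= ip (A y) (c - y).
Proof.
move=> l_lin [Ml0 Ml0P] K_closed [k0 Kk0] K_convex.
have l0 : l 0 = 0 by have := l_lin 1 0 0; rewrite scale1r addr0; lra.
have lD x y : l (x + y) = l x + l y by rewrite -{1}[x]scale1r l_lin mul1r.
have lZ a x : l (a *: x) = a * l x by rewrite -[_ *: _]addr0 l_lin l0 addr0.
have lN x : l (- x) = - l x by rewrite -scaleN1r lZ mulN1r.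
pose Ml := Num.max Ml0 0.
have Ml_ge0 : 0 <= Ml by rewrite le_max lexx orbT.
have MlP x : `|l x| <= Ml * `|x|.
  by apply: le_trans (Ml0P x) _; rewrite ler_wpM2r// le_max lexx.
have [MA MA_ge0 MAP] := bounded_operator_ge0 A_bounded.
pose a x y := ip (A x) y.
have aC x y : a x y = a y x by rewrite /a A_symmetric ipC.
have aDl x y z : a (x + y) z = a x z + a y z by rewrite /a linearD ipDl.
have aZl c x z : a (c *: x) z = c * a x z by rewrite /a linearZ ipZl.
have aNl x z : a (- x) z = - a x z by rewrite /a linearN ipNl.
have aDr x y z : a z (x + y) = a z x + a z y by rewrite /a ipDr.
have aZr c x z : a z (c *: x) = c * a z x by rewrite /a ipZr.
have aNr x z : a z (- x) = - a z x by rewrite /a ipNr.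
have aE := (aDl, aZl, aNl, aDr, aZr, aNr, lD, lZ, lN).
have a_ge0 x : 0 <= a x x.
  by apply: le_trans (A_coercive x); rewrite mulr_ge0 ?sqr_ge0// ltW.
have a_le x y : a x y <= MA * `|x| * `|y|.
  by apply: le_trans (cauchy_schwarz ip_norm _ _) _; rewrite ler_wpM2r.
pose J x := a x x - 2 * l x.
(* Completing the square in [beta |x|^2 - 2 Ml |x|]. *)
have J_lb x : - (Ml ^+ 2 / beta) <= J x.
  have h1 := A_coercive x; have h2 := MlP x.
  have h3 : l x <= Ml * `|x| by apply: le_trans h2; exact: ler_norm.
  rewrite lerNl ler_pdivlMr// /J.
  have : 0 <= (beta * `|x| - Ml) ^+ 2 by exact: sqr_ge0.
  rewrite -/(a x x) in h1.
  have := ler_wpM2l (ltW beta_gt0) h1; have := ler_wpM2l (ltW beta_gt0) h3.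
  lra.
have J_inf : has_inf (J @` K).
  by split; [exists (J k0), k0 | exists (- (Ml ^+ 2 / beta)) => _ [x _ <-]].
pose m := inf (J @` K).
have m_le x : K x -> m <= J x by move=> Kx; apply: ge_inf;
  [exact: J_inf.2 | exists x].
(* Parallelogram identity: [J x + J y - 2 J z], with [z] the midpoint, equals half of
   [a (y - x) (y - x)], and [m <= J z]. *)
have J_mid x y : K x -> K y -> beta / 2 * `|y - x| ^+ 2 <= J x + J y - 2 * m.
  move=> Kx Ky.
  have h0 := A_coercive (y - x).
  have h1 : K (x + 2^-1 *: (y - x)) by apply: K_convex => //; lra.
  have := m_le _ h1; rewrite /J; rewrite -/(a _ _) in h0.
  rewrite !aE in h0 *; rewrite (aC y x) in h0 *; lra.
(* The tolerance is quadratic in [2 ^ - n] because [J_mid] controls squared distances; consecutive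
   terms are then within [2 / 2 ^ n]. *)
have seqP n : exists x, K x /\ J x < m + beta * (4^-1) ^+ n.
  have [|_ [x Kx <-] hx] := inf_adherent _ J_inf (eps := beta * (4^-1) ^+ n);
    first by rewrite mulr_gt0// exprn_gt0.
  by exists x.
have [x xP] := choice seqP.
have x_geo n : `|x n.+1 - x n| <= 2 / 2 ^+ n.
  have [K0 J0] := xP n; have [K1 J1] := xP n.+1.
  have h := J_mid _ _ K0 K1.
  rewrite -(@ler_pXn2r _ 2%N) ?nnegrE ?divr_ge0 ?exprn_ge0//.
  rewrite expr_div_n -exprM mulnC exprM -(ler_pM2l beta_gt0).
  rewrite exprS in J1.
  have -> : (2 : R) ^+ 2 = 4 by rewrite -natrX.
  rewrite -exprVn; have : 0 < (4^-1 : R) ^+ n by rewrite exprn_gt0.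
  move: (4^-1 ^+ n) J0 J1 h => q J0 J1 h q0.
  by have := mulr_gt0 beta_gt0 q0; lra.
have [y yP] := geometric_cvg x_geo.
have Ky : K y.
  apply: (@closed_cvg _ _ \oo _ x K K_closed).
    by apply: nearW => n; have [] := xP n.
  apply/cvgrPdist_lt => e e0; have [N hN] := @geometric_lt _ (2 * 2) _ e0.
  exists N => // n /= Nn; apply: le_lt_trans (yP n) (le_lt_trans _ hN).
  by rewrite ler_wpM2l// lef_pV2 ?posrE ?exprn_gt0// ler_eXn2l// ltr1n.
(* By symmetry [J y - J (x n)] is [a (y - x n) (y + x n) - 2 l (y - x n)], which is of the order of
   [|y - x n| <= 4 / 2 ^ n]; the term [beta] of the constant comes from the tolerance. *)
have Jy : J y <= m.
  apply: (@le_geometric _ _ _ (beta + (MA * (2 * `|y| + 4) + 2 * Ml) * 4)) => n.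
  have [_ Jx] := xP n; have hy := yP n.
  have h2n : (1 : R) <= 2 ^+ n by apply: exprn_ege1; lra.
  have h4n : (4^-1 : R) ^+ n <= (2 ^+ n)^-1.
    rewrite -exprVn; apply: lerXn2r; rewrite ?nnegrE; lra.
  have i2n : (2 ^+ n)^-1 <= 1 :> R by rewrite invf_le1.
  have J_diff : J y - J (x n) =
    a (y - x n) (2 *: y - (y - x n)) - 2 * l (y - x n).
    by rewrite /J !aE (aC (x n) y); lra.
  have h1 := a_le (y - x n) (2 *: y - (y - x n)).
  have h2 : `|2 *: y - (y - x n)| <= 2 * `|y| + `|y - x n|.
    by apply: le_trans (ler_normB _ _) _; rewrite normrZ gtr0_norm.
  have h3 := MlP (x n - y).
  have h4 : l (x n - y) <= Ml * `|y - x n| by rewrite distrC;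
    apply: le_trans h3; exact: ler_norm.
  have h4' : l (x n - y) = - l (y - x n) by rewrite !aE; lra.
  have d0 := normr_ge0 (y - x n).
  have d_le : `|y - x n| <= 4 / 2 ^+ n by lra.
  have d4 : `|y - x n| <= 4 by lra.
  have e1 : MA * `|y - x n| * `|2 *: y - (y - x n)|
      <= MA * `|y - x n| * (2 * `|y| + 4).
    by apply: ler_wpM2l; [exact: mulr_ge0 | lra].
  have c0 : 0 <= MA * (2 * `|y| + 4) + 2 * Ml.
    by apply: addr_ge0; apply: mulr_ge0 => //; have := normr_ge0 y; lra.
  have e2 := ler_wpM2l c0 d_le.
  have e3 := ler_wpM2l (ltW beta_gt0) h4n.
  lra.
exists y => // c Kc.
have [d dE] : exists d, d = c - y by exists (c - y).
have hmin t : 0 <= t -> t <= 1 -> 0 <= t * (2 * (a y d - l d) + t * a d d).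
  move=> t0 t1; have := m_le _ (K_convex _ _ _ t0 t1 Ky Kc).
  rewrite -dE => hm; have := le_trans Jy hm.
  rewrite /J !aE (aC d y); lra.
rewrite -dE -/(a y d) leNgt; apply/negP => hlt.
have sd := a_ge0 d.
have q0 : 0 < a d d + (l d - a y d) by lra.
(* If [s = l d - a y d] were positive, the step [s / (a d d + s)] would lie in []0, 1]] and make the
   bracket of [hmin] at most [- s]. The summand [s] in the denominator covers [a d d = 0]. *)
have := hmin ((l d - a y d) / (a d d + (l d - a y d))).
rewrite divr_ge0 ?ler_pdivrMr// ?mul1r; [|lra|lra].
move=> /(_ isT); have -> : l d - a y d <= a d d + (l d - a y d) by lra.
move=> /(_ isT).
rewrite pmulr_rge0; last by rewrite divr_gt0//; lra.
rewrite leNgt => /negP; apply.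
rewrite -(ltr_pM2r q0) mul0r mulrDl [_ / _ * _ * _]mulrAC divfK ?gt_eqF//.
nra.
Qed.

End variational_inequality.

(** * Lax-Milgram, Riesz representation and existence of the velocity *)

Section representation.
Context (R : realType) (H : completeNormedModType R).
Context (ip : {dot H for (@idfun R)}).
Hypothesis ip_norm : forall x : H, ip x x = `|x| ^+ 2.

(** With the whole space as constraint set, every [y] is an admissible direction at the solution;
    the inequalities for [y] and [- y] combine into an equality. *)
Lemma symmetric_lax_milgram (A : {linear H -> H}) (beta : R) (l : H -> R) :
  0 < beta -> bounded_operator A -> symmetric_operator ip A ->
  (forall x : H, beta * `|x| ^+ 2 <= ip (A x) x) ->
  (forall a x y, l (a *: x + y) = a * l x + l y) ->
  (exists M, forall x, `|l x| <= M * `|x|) ->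
  exists z, forall y, ip (A z) y = l y.
Proof.
move=> b0 Ab As Ac l_lin l_bd.
have [||z _ hz] := symmetric_stampacchia ip_norm b0 Ab As Ac l_lin l_bd
  (@closedT H) => //.
  by exists 0.
have h y : l y <= ip (A z) y by have := hz (y + z) I; rewrite addrK.
exists z => y; apply/eqP; rewrite eq_le h andbT.
have := h (- y); rewrite ipNr -scaleN1r.
have l0 : l 0 = 0 by have := l_lin 1 0 0; rewrite scale1r addr0; lra.
by rewrite -[_ *: _]addr0 l_lin l0; lra.
Qed.

Lemma riesz_representation (l : H -> R) :
  (forall a x y, l (a *: x + y) = a * l x + l y) ->
  (exists M, forall x, `|l x| <= M * `|x|) ->
  exists z, forall y, ip z y = l y.
Proof.
apply: (@symmetric_lax_milgram idfun 1) => //.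
- by exists 1 => x; rewrite mul1r.
- by move=> x; rewrite mul1r ip_norm.
Qed.

Context (A B : {linear H -> H}) (beta : R).
Hypotheses (beta_gt0 : 0 < beta) (A_bounded : bounded_operator A)
  (A_symmetric : symmetric_operator ip A)
  (A_coercive : forall x : H, beta * `|x| ^+ 2 <= ip (A x) x).

Lemma coercive_surjective b : exists z, A z = b.
Proof.
have [||z hz] := symmetric_lax_milgram (l :=
  ip b) beta_gt0 A_bounded A_symmetric A_coercive.
- by move=> a x y; rewrite ipDr ipZr.
- by exists `|b| => x; exact: normr_ip.
exists z; apply/eqP; rewrite -subr_eq0 -normr_eq0 -sqrf_eq0 -ip_norm.
by rewrite {1}ipBl hz subrr.
Qed.

Definition velocity_spec (C : set H) (u y : H) :=
  C (A y + B u) /\ forall c, C c -> 0 <= ip y (c - (A y + B u)).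

Lemma normal_coneP C u y :
  normal_cone ip C (A y + B u) (- y) <-> velocity_spec C u y.
Proof.
by split=> -[Cy h]; split=> // c /h;
  rewrite ipNl ?oppr_le0// -oppr_ge0 ipNl opprK.
Qed.

(** The variational inequality is solved with [l = 0] on the set of [y] with [A y + B u] in [C],
    which is closed as [A] is continuous and nonempty as [A] is onto. *)
Lemma velocity_exists C u : closed C -> C !=set0 -> convex_set C ->
  exists y, velocity_spec C u y.
Proof.
move=> C_closed [c0 Cc0] C_convex.
pose K := [set y | C (A y + B u)].
have [y0 y0P] := coercive_surjective (c0 - B u).
have Ac : continuous A.
  apply/linear_bounded_continuous/linear_boundedP.
  have [M hM] := A_bounded; near=> r => x.
  by apply: le_trans (hM x) _; rewrite ler_wpM2r//; near: r;
    exact: nbhs_pinfty_ge.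
have [|||||y Ky yP] :=
  @symmetric_stampacchia _ _ _ ip_norm A _ beta_gt0 A_bounded A_symmetric
    A_coercive (fun=> 0) K.
- by move=> *; rewrite mulr0 addr0.
- by exists 0 => x; rewrite normr0 mul0r.
- apply: (@preimage_closed _ _ (fun y => A y + B u)) => // y _.
  by apply: cvgD; [exact: Ac | exact: cvg_cst].
- by exists y0; rewrite /K/= y0P subrK.
- move=> a x y a0 a1 Kx Ky.
  rewrite /K/= linearD linearZ linearB.
  have := C_convex (A y + B u) (A x + B u) (Itv01 a0 a1).
  rewrite !inE => /(_ Ky Kx); congr C.
  rewrite /conv/= /unstable.onem scalerBl scale1r addrCA -scalerBr.
  by rewrite opprD addrACA subrr addr0 addrAC.
(* Surjectivity writes [c] as [A z + B u]; by symmetry [<A y, z - y>] is [<y, c - (A y + B u)>]. *)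
exists y; split=> // c Cc; have [z zP] := coercive_surjective (c - B u).
have Kz : K z by rewrite /K/= zP subrK.
have := yP _ Kz; rewrite A_symmetric linearB zP; congr (0 <= ip y _).
by rewrite opprD addrA addrAC.
Unshelve. all: by end_near.
Qed.

End representation.

(** * The velocity prescribed by the inclusion *)

(** The distance to a set is an infimum, so the slack [e] stands in for a nearest point. *)
Lemma hausdorff_dist_near (R : realType) (H : normedModType R) (C1 C2 : set H)
    (d e : R) (x : H) :
  (hausdorff_dist C1 C2 <= d%:E)%E -> 0 < e -> C2 x ->
  exists2 y, C1 y & `|x - y| <= d + e.
Proof.
rewrite /hausdorff_dist ge_max => /andP[h _] e0 C2x.
have hx : (set_dist C1 x <= d%:E)%E.
  by apply: le_trans h; apply: ereal_sup_ubound; exists x.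
have : (set_dist C1 x < (d + e)%:E)%E.
  by apply: le_lt_trans hx _; rewrite lte_fin ltrDl.
move=> /ereal_inf_lt[_ [y C1y <-]]; rewrite lte_fin => /ltW yx.
by exists y.
Qed.

Lemma hausdorff_distC (R : realType) (H : normedModType R) (C1 C2 : set H) :
  hausdorff_dist C1 C2 = hausdorff_dist C2 C1.
Proof. exact: maxC. Qed.

Section velocity.
Context (R : realType) (H : completeNormedModType R).
Context (ip : {dot H for (@idfun R)}).
Hypothesis ip_norm : forall x : H, ip x x = `|x| ^+ 2.
Context (A B : {linear H -> H}) (beta : R).
Hypotheses (beta_gt0 : 0 < beta)
  (A_coercive : forall x : H, beta * `|x| ^+ 2 <= ip (A x) x).

(** Testing each variational inequality at the point [A y + B u] of the other and adding gives [<A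
    (y1 - y2), y1 - y2> <= <B (u2 - u1), y1 - y2>]; coercivity and Cauchy-Schwarz finish. *)
Lemma velocity_lipschitz M (C : set H) u1 u2 y1 y2 :
  (forall x, `|B x| <= M * `|x|) ->
  velocity_spec ip A B C u1 y1 -> velocity_spec ip A B C u2 y2 ->
  beta * `|y1 - y2| <= M * `|u1 - u2|.
Proof.
move=> MB [C1 h1] [C2 h2]; have := h1 _ C2; have := h2 _ C1 => {h1 h2} h1 h2.
have hA := A_coercive (y1 - y2).
have hB : ip (A (y1 - y2)) (y1 - y2) <= ip (B (u2 - u1)) (y1 - y2).
  rewrite (linearB A) (linearB B) !(ipBl, ipBr, ipDl, ipDr).
  rewrite !(ipBl, ipBr, ipDl, ipDr) in h1 h2.
  have c1 := ipC ip (A y1); have c2 := ipC ip (A y2).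
  have c3 := ipC ip (B u1); have c4 := ipC ip (B u2).
  rewrite !(c1, c2, c3, c4); lra.
have hB' := le_trans hB (cauchy_schwarz ip_norm _ _).
have := le_trans hA hB'; rewrite expr2 mulrA.
have [->|y0] := eqVneq (y1 - y2) 0.
  rewrite normr0 !mulr0 => _; exact: le_trans (normr_ge0 _) (MB _).
rewrite ler_pM2r ?normr_gt0// => /le_trans; apply.
by rewrite -normrN -linearN opprB.
Qed.

Lemma velocity_unique (C : set H) u y1 y2 : bounded_operator B ->
  velocity_spec ip A B C u y1 -> velocity_spec ip A B C u y2 -> y1 = y2.
Proof.
move=> [M MB] h1 h2; have := velocity_lipschitz MB h1 h2.
rewrite subrr normr0 mulr0 pmulr_rle0// normr_le0 subr_eq0.
by move/eqP.
Qed.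

(** The same test as for [velocity_lipschitz], except that each point must first be moved into the
    other set. The error, at most [d] plus a slack, is multiplied by [|y1|] or [|y2|] rather than by
    [|y1 - y2|], hence the exponent 1/2. *)
Lemma velocity_holder (C1 C2 : set H) u y1 y2 d :
  (hausdorff_dist C1 C2 <= d%:E)%E ->
  velocity_spec ip A B C1 u y1 -> velocity_spec ip A B C2 u y2 ->
  beta * `|y1 - y2| ^+ 2 <= (`|y1| + `|y2|) * d.
Proof.
move=> h12 [z1 h1] [z2 h2]; have h21 := h12; rewrite hausdorff_distC in h21.
set n := `|y1| + `|y2|.
have n0 : 0 <= n by apply: addr_ge0.
apply/ler_addgt0Pr => e e0.
have e1 : 0 < e / (n + 1) by apply: divr_gt0 => //; lra.
have [c1 C1c1 hc1] := hausdorff_dist_near h12 e1 z2.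
have [c2 C2c2 hc2] := hausdorff_dist_near h21 e1 z1.
have := h1 _ C1c1; have := h2 _ C2c2 => k2 k1.
apply: le_trans (A_coercive _) _.
have cs1 := cauchy_schwarz ip_norm y1 (c1 - (A y2 + B u)).
have cs2 := cauchy_schwarz ip_norm y2 (c2 - (A y1 + B u)).
have f1 : `|y1| * `|c1 - (A y2 + B u)| <= `|y1| * (d + e / (n + 1)).
  by rewrite ler_wpM2l// distrC.
have f2 : `|y2| * `|c2 - (A y1 + B u)| <= `|y2| * (d + e / (n + 1)).
  by rewrite ler_wpM2l// distrC.
have f3 : n * (e / (n + 1)) <= e.
  by rewrite mulrCA ger_pMr// ler_pdivrMr; lra.
suff : ip (A (y1 - y2)) (y1 - y2) <= n * (d + e / (n + 1)) by lra.
have -> : n * (d + e / (n + 1)) =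
  `|y1| * (d + e / (n + 1)) + `|y2| * (d + e / (n + 1)) by rewrite mulrDl.
apply: le_trans (lerD (le_trans cs1 f1) (le_trans cs2 f2)).
rewrite (linearB A) !(ipBl, ipBr, ipDl, ipDr).
rewrite !(ipBl, ipBr, ipDl, ipDr) in k1 k2.
rewrite !(ipC ip (A _)); lra.
Qed.

End velocity.

(** * Monotonicity from one-sided derivatives *)

Section growth.
Context (R : realType).
Local Notation mu := (@lebesgue_measure R).

(** Let [tau] be the supremum of the points where [g t <= g a]. The left condition forbids an upward
    jump, so [tau] is such a point; the right condition would carry the inequality past [tau] if
    [tau < b]. *)
Lemma right_nonincreasing (g : R -> R) (a b : R) : a <= b ->
  (forall t, a < t -> t <= b -> forall e, 0 < e ->
     \forall s \near t^'-, g t <= g s + e) ->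
  (forall t, a <= t -> t < b -> \forall s \near t^'+, g s <= g t) ->
  g b <= g a.
Proof.
move=> ab gl gr.
pose S := [set t | a <= t /\ t <= b /\ g t <= g a].
have Sa : S a by split.
have S_sup : has_sup S by split; [exists a | exists b => t [_ []]].
pose tau := sup S.
have tau_ge t : S t -> t <= tau by move=> St; apply: ub_le_sup;
  first exact: S_sup.2.
have a_tau : a <= tau by exact: tau_ge.
have tau_b : tau <= b by apply: ge_sup => [|t [_ []]]; first by exists a.
have gtau : g tau <= g a.
  have [->//|tau_a] := eqVneq tau a.
  have {}tau_a : a < tau by rewrite lt_neqAle eq_sym tau_a.
  apply/ler_addgt0Pr => e e0.
  have [d /= d0 hd] := gl _ tau_a tau_b _ e0.
  have [s Ss hs] := sup_adherent d0 S_sup; rewrite -/tau in hs.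
  have [<-|s_tau] := eqVneq s tau; first by have [_ [_ h]] := Ss; lra.
  have {}s_tau : s < tau by rewrite lt_neqAle s_tau tau_ge.
  have /hd : ball tau d s by rewrite -ball_normE /ball_/= gtr0_norm; lra.
  by have [_ [_ h]] := Ss; move=> /(_ s_tau); lra.
have [<-//|tau_neq] := eqVneq tau b.
have {}tau_b : tau < b by rewrite lt_neqAle tau_neq.
have [d /= d0 hd] := gr _ a_tau tau_b.
pose s := tau + Num.min (d / 2) (b - tau).
have m0 : 0 < Num.min (d / 2) (b - tau) by rewrite lt_min divr_gt0//= subr_gt0.
have m1 : Num.min (d / 2) (b - tau) <= d / 2 by rewrite ge_min lexx.
have m2 : Num.min (d / 2) (b - tau) <= b - tau by rewrite ge_min lexx orbT.
have ts : tau < s by rewrite /s; lra.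
have /hd/(_ ts) gs : ball tau d s by rewrite -ball_normE /ball_/= ltr0_norm /s;
  lra.
have : s <= tau by apply: tau_ge; split; [|split]; rewrite /s in ts gs *; lra.
by rewrite leNgt ts.
Qed.

(** Outer regularity bounds the measure of [U] minus a measurable null superset of [N]; putting that
    null set back costs nothing. *)
Lemma negligible_open_cover (N : set R) (e : R) : mu.-negligible N -> 0 < e ->
  exists U : set R, [/\ open U, N `<=` U & (mu U < e%:E)%E].
Proof.
move=> [N' [mN' N'0 NN']] e0.
have [U [oU N'U hU]] :=
  @lebesgue_regularity_outer _ _ _ mN' (eq_ind_r (fun x => (x < +oo)%E) (ltry
    0) N'0) e0.
exists U; split => //; first exact: subset_trans NN' N'U.
apply: le_lt_trans hU; rewrite -[leRHS]adde0 -N'0.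
rewrite -[in leLHS](setDUK N'U) setUC.
apply: measureU2 => //; apply: measurableD => //;
  exact: measurable_realfun.open_measurable.
Qed.

(* With U an open set of measure < e covering the exceptional set N, subtracting
   M * mu (U `&` [a, t]) from f compensates, at the points of N, the growth that
   only the one-sided Lipschitz bound controls. *)
Lemma ae_right_nonincreasing (f : R -> R) (a b M : R) (N : set R) : a <= b ->
  0 <= M ->
  (forall s t, a <= s -> s <= t -> t <= b -> f t - f s <= M * (t - s)) ->
  mu.-negligible N ->
  (forall t, a <= t -> t < b -> ~ N t -> forall e, 0 < e ->
     \forall s \near t^'+, f s - f t <= e * (s - t)) ->
  f b <= f a.
Proof.
move=> ab M0 f_lip N0 f_right.
suff h e : 0 < e -> f b <= f a + e * (b - a) + M * e.
  apply/ler_addgt0Pr => e e0.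
  have D0 : 0 < b - a + M + 1 by lra.
  have := h (e / (b - a + M + 1)) (divr_gt0 e0 D0).
  suff : e / (b - a + M + 1) * (b - a + M) <= e by lra.
  by rewrite mulrAC ler_pdivrMr// ler_pM2l//; lra.
move=> e0.
have [U [oU NU Ue]] := negligible_open_cover N0 e0.
have mU : measurable U by exact: measurable_realfun.open_measurable.
pose m (t : R) := fine (mu (U `&` `[a, t])).
have mUI (t : R) : measurable (U `&` `[a, t]) by exact: measurableI.
have mu_le (t : R) : (mu (U `&` `[a, t]) <= mu U)%E.
  by apply: le_measure;
    [exact: mem_set (mUI _) | exact: mem_set | exact: subIsetl].
have mu_fin (t : R) : mu (U `&` `[a, t]) \is a fin_num.
  by rewrite ge0_fin_numE//;
    apply: le_lt_trans (mu_le t) (lt_trans Ue (ltry _)).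
have m_ge0 t : 0 <= m t by rewrite fine_ge0.
have m_le t : m t <= e.
  by rewrite -lee_fin fineK//; apply: le_trans (mu_le t) (ltW Ue).
have m_homo s t : s <= t -> m s <= m t.
  move=> st; rewrite fine_le//; apply: le_measure;
    [exact: mem_set (mUI _) | exact: mem_set (mUI _) |].
  by apply: setIS; apply: subset_itvl; rewrite bnd_simp.
(* The sets [U] intersected with [[a, s]] and []s, t]] are disjoint and both lie in [U] intersected
   with [[a, t]]. *)
have m_add s t : a <= s -> s <= t -> `]s, t] `<=` U -> m s + (t - s) <= m t.
  move=> as_ st stU; rewrite -lee_fin EFinD !fineK//.
  have -> : (t - s)%:E = mu `]s, t].
    by rewrite lebesgue_measure_itv/= lte_fin; case: ltP => // ts; congr EFin;
      lra.
  rewrite -[leLHS](measureU mu (mUI s) (measurable_itv _)); last first.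
    rewrite -subset0 => x [[_ /=]];
      rewrite !in_itv/= => /andP[_ xs] /andP[sx _].
    by move: sx; rewrite ltNge xs.
  apply: le_measure; [| exact: mem_set (mUI _) |].
    by apply/mem_set; apply: measurableU; [exact: mUI | exact: measurable_itv].
  move=> x [[Ux]|] /=; rewrite !in_itv/= => /andP[h1 h2].
    by split=> //; rewrite /= ?in_itv/= h1 (le_trans h2).
  by split=> /=; [apply: stU;
    rewrite /= ?in_itv/= h1 | rewrite ?in_itv/= h2 andbT; lra].
pose g t := f t - e * (t - a) - M * m t.
suff : g b <= g a.
  have := m_ge0 a; have := m_le b; rewrite /g => h1 h2.
  have := ler_wpM2l M0 h1; have := mulr_ge0 M0 h2; lra.
apply: right_nonincreasing => // t ta tb.
- move=> e' e'0.
  near=> s.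
  have st : s < t by near: s; exact: nbhs_left_lt.
  have as_ : a <= s by near: s; exact: nbhs_left_ge.
  have := f_lip _ _ as_ (ltW st) tb.
  have h1 := ler_wpM2l M0 (m_homo _ _ (ltW st)).
  have h2 : e * (s - a) <= e * (t - a) by rewrite ler_pM2l//; lra.
  have h3 : M * (t - s) <= e'.
    have : t - s <= e' / (M + 1).
      rewrite lerBlDr addrC -lerBlDr; near: s; apply: nbhs_left_ge.
      by rewrite ltrBlDr ltrDl divr_gt0//; lra.
    rewrite ler_pdivlMr; last lra.
    by lra.
  by rewrite /g; lra.
(* At a point of [N], []t, s]] lies in [U] for [s] close to [t], so [M * m] grows by at least
   [M * (s - t)] and cancels the Lipschitz bound. Elsewhere the term [e * (t - a)] absorbs the
   growth of [f]. *)
- have [Nt|Nt] := pselect (N t).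
    have [d /= d0 hd] : nbhs t U by apply: open_nbhs_nbhs; split => //;
      exact: NU.
    near=> s.
    have ts : t < s by near: s; exact: nbhs_right_gt.
    have sb : s <= b by near: s; exact: nbhs_right_le.
    have std : s < t + d by near: s; apply: nbhs_right_lt; rewrite ltrDl.
    have tsU : `]t, s] `<=` U.
      move=> x /=; rewrite in_itv/= => /andP[tx xs]; apply: hd.
      by rewrite /ball/= ltr0_norm; lra.
    have := f_lip _ _ ta (ltW ts) sb.
    have h1 := ler_wpM2l M0 (m_add _ _ ta (ltW ts) tsU).
    have h2 : e * (t - a) <= e * (s - a) by rewrite ler_pM2l//; lra.
    by rewrite /g; lra.
  near=> s.
  have ts : t < s by near: s; exact: nbhs_right_gt.
  have hs : f s - f t <= e * (s - t) by near: s; exact: f_right.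
  have h1 := ler_wpM2l M0 (m_homo _ _ (ltW ts)).
  by rewrite /g; lra.
Unshelve. all: by end_near.
Qed.

End growth.

(** * Mean value inequality and primitives in Hilbert space *)

Section mean_value.
Context (R : realType) (V : normedModType R).

Lemma is_derive_near (D : R -> V) (t : R) (v : V) (e : R) :
  is_derive t 1 D v -> 0 < e ->
  \forall s \near t, `|D s - D t - (s - t) *: v| <= e * `|s - t|.
Proof.
move=> [Dt <-] e0; have /cvgrPdist_le/(_ _ e0)[d /= d0 hd] := Dt.
exists d => // s /=; rewrite distrC => st.
have [->|neq] := eqVneq s t; first
  by rewrite !subrr scale0r subrr !normr0 mulr0.
have st0 : s - t != 0 by rewrite subr_eq0.
have := hd (s - t); rewrite /ball_/= sub0r normrN => /(_ st st0).
rewrite [_ *: 1]mulr1 subrK => h.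
have -> : D s - D t - (s - t) *: 'D_1 D t =
  - ((s - t) *: ('D_1 D t - (s - t)^-1 *: (D s - D t))).
  by rewrite scalerBr scalerA divff// scale1r opprB.
by rewrite normrN normrZ mulrC ler_wpM2r.
Qed.

Lemma near_is_derive (D : R -> V) (t : R) (v : V) :
  (forall e, 0 < e ->
     \forall s \near t, `|D s - D t - (s - t) *: v| <= e * `|s - t|) ->
  is_derive t 1 D v.
Proof.
move=> h.
have Dv : h^-1 *: (D (h *: 1 + t) - D t) @[h --> 0^'] --> v.
  apply/cvgrPdist_le => e e0; have [d /= d0 hd] := h _ e0.
  exists d => // k /=; rewrite sub0r normrN => kd k0.
  have := hd (k + t); rewrite /ball_/= opprD addrCA subrr addr0 normrN addrK.
  move=> /(_ kd); rewrite [k *: 1]mulr1 => hk.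
  have -> : v - k^-1 *: (D (k + t) - D t) =
    - (k^-1 *: (D (k + t) - D t - k *: v)).
    by rewrite [in RHS]scalerBr scalerA mulVf// scale1r opprB.
  by rewrite normrN normrZ normfV ler_pdivrMl ?normr_gt0// mulrC.
apply: DeriveDef; first by apply/cvg_ex; exists v.
exact: cvg_lim Dv.
Qed.

Lemma is_derive_near_right (D : R -> V) (t : R) (v : V) (e : R) :
  is_derive t 1 D v -> 0 < e ->
  \forall s \near t^'+, `|D s - D t| <= `|v| * (s - t) + e * (s - t).
Proof.
move=> Dt e0; have [d /= d0 hd] := is_derive_near Dt e0.
exists d => // s /= /hd; move=> h ts.
have st0 : 0 < s - t by rewrite subr_gt0.
rewrite gtr0_norm// in h.
have := ler_normD (D s - D t - (s - t) *: v) ((s - t) *: v).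
by rewrite subrK normrZ (gtr0_norm st0) mulrC; lra.
Qed.

Lemma is_derive_continuous (D : R -> V) (t : R) (v : V) :
  is_derive t 1 D v -> {for t, continuous D}.
Proof.
by move=> Dt; apply: differentiable_continuous; apply/derivable1_diffP;
  exact: ex_derive.
Qed.

(** The majorant [phi] enters only through its increments, so that linear and exponential bounds are
    treated alike. A slope [e] absorbs the first-order remainder, which makes
    [|D s - D a| - phi s - e s] nonincreasing. *)
Lemma mean_value_inequality (D D' : R -> V) (phi : R -> R) (a b : R) : a <= b ->
  (forall t, a <= t -> t <= b -> is_derive t 1 D (D' t)) ->
  (forall t s, a <= t -> t <= s -> s <= b ->
     `|D' t| * (s - t) <= phi s - phi t) ->
  `|D b - D a| <= phi b - phi a.
Proof.
move=> ab DD' hphi.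
suff h e : 0 < e -> `|D b - D a| <= phi b - phi a + e * (b - a).
  apply/ler_addgt0Pr => e e0.
  have D0 : 0 < b - a + 1 by lra.
  have := h (e / (b - a + 1)) (divr_gt0 e0 D0).
  suff : e / (b - a + 1) * (b - a) <= e by lra.
  by rewrite mulrAC ler_pdivrMr// ler_pM2l//; lra.
move=> e0.
pose g s := `|D s - D a| - phi s - e * s.
suff : g b <= g a by rewrite /g subrr normr0; lra.
apply: right_nonincreasing => // t ta tb.
- move=> e' e'0.
  have /cvgrPdist_le/(_ _ e'0) := is_derive_continuous (DD' _ (ltW ta) tb).
  move=> [d /= d0 hd].
  near=> s.
  have st : s < t by near: s; exact: nbhs_left_lt.
  have as_ : a <= s by near: s; exact: nbhs_left_ge.
  have std : t - d < s by near: s; apply: nbhs_left_gt; rewrite ltrBlDr ltrDl.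
  have /hd Ds : `|t - s| < d by rewrite gtr0_norm; lra.
  have hp := hphi _ _ as_ (ltW st) tb.
  have hp' : 0 <= `|D' s| * (t - s) by rewrite mulr_ge0//; lra.
  have := ler_normD (D t - D s) (D s - D a); rewrite subrKA.
  have : e * s <= e * t by rewrite ler_pM2l// ltW.
  by rewrite /g; lra.
- near=> s.
  have ts : t < s by near: s; exact: nbhs_right_gt.
  have sb : s <= b by near: s; exact: nbhs_right_le.
  have hs : `|D s - D t| <= `|D' t| * (s - t) + e * (s - t).
    by near: s; apply: is_derive_near_right => //; apply: DD' => //; exact: ltW.
  have hp := hphi _ _ ta (ltW ts) sb.
  have := ler_normD (D s - D t) (D t - D a); rewrite subrKA.
  by rewrite /g; lra.
Unshelve. all: by end_near.
Qed.

End mean_value.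

Section primitive.
Context (R : realType) (H : completeNormedModType R).
Context (ip : {dot H for (@idfun R)}).
Hypothesis ip_norm : forall x : H, ip x x = `|x| ^+ 2.
Local Notation mu := (@lebesgue_measure R).

Lemma ip_continuous (f : R -> H) y : continuous f -> continuous (fun s => ip (f
  s) y).
Proof.
move=> fc t; apply/cvgrPdist_le => e e0.
have e1 : 0 < e / (`|y| + 1) by rewrite divr_gt0// ltr_wpDl.
have /cvgrPdist_le/(_ _ e1) := fc t; apply: filterS => s hs.
rewrite -ipBl; apply: le_trans (normr_ip ip_norm _ _) _.
apply: le_trans (ler_wpM2r (normr_ge0 _) hs) _.
have := normr_ge0 y => y0.
by rewrite mulrAC ler_pdivrMr ?ltr_wpDl// ler_pM2l//; lra.
Qed.

(* The primitive is defined weakly: G t is the Riesz representative of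
   y |-> \int_0^t <f s, y> ds. Integrating from -1 makes it differentiable at 0,
   where the Picard iterates start. *)
Lemma continuous_primitive (f : R -> H) : continuous f ->
  exists2 G : R -> H, G 0 = 0 & 
    forall t : R, -1 < t -> is_derive t (1 : R) G (f t).
Proof.
move=> fc.
pose p y t := \int[mu]_(s in `[-1, t]) ip (f s) y.
have p_int y t : mu.-integrable `[-1, t] (EFin \o (fun s => ip (f s) y)).
  apply: continuous_compact_integrable; first exact: segment_compact.
  by apply: continuous_subspaceT; exact: ip_continuous.
have p_derive y (t : R) : -1 < t -> is_derive t (1 : R) (p y) (ip (f t) y).
  move=> t1; have tt : t < t + 1 by rewrite ltrDl.
  have [h1 h2] := continuous_FTC1_closed tt (p_int y (t + 1)) t1
    (@ip_continuous _ y fc t).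
  by apply: DeriveDef; [exact: h1 | rewrite -derive1E h2].
have p_lin t a y z : p (a *: y + z) t = a * p y t + p z t.
  rewrite /p -RintegralZl// -RintegralD//; first last.
    have -> : EFin \o (fun s => a * ip (f s) y) =
      EFin \o (fun s => ip (f s) (a *: y)).
      by apply/funext => s /=; rewrite ipZr.
    exact: p_int.
  by apply: eq_Rintegral => s _; rewrite ipDr ipZr.
(* Comparison of [f] with a constant vector [v]: [v = 0] will give boundedness in [y], and [v = f t]
   the derivative at [t]. *)
have p_near y v a b K : -1 < a -> a <= b ->
    (forall r, a <= r -> r <= b -> `|f r - v| <= K) ->
    `|p y b - p y a - (b - a) * ip v y| <= K * (b - a) * `|y|.
  move=> a1 ab fK.
  pose k : R -> R := p y - (ip v y \*: (@idfun R)).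
  have k_derive (t : R) : a <= t -> t <=
    b -> is_derive t (1 : R) k (ip (f t) y - ip v y *: 1).
    move=> ta _; have t1 : -1 < t by lra.
    exact: (is_deriveB (p_derive y t t1) (is_deriveZ (ip v y) (is_derive_id t
      (1 : R)))).
  have -> : p y b - p y a - (b - a) * ip v y = k b - k a.
    have kE r : k r = p y r - ip v y * r by [].
    by rewrite !kE; lra.
  have := @mean_value_inequality _ _ k _ (fun r => K * `|y| * r) a b ab
    k_derive.
  rewrite -mulrBr mulrAC; apply => r s ar rs sb.
  rewrite -mulrBr ler_wpM2r ?subr_ge0// [_ *: 1]mulr1 -ipBl.
  by apply: le_trans (normr_ip ip_norm _ _) _; rewrite ler_wpM2r// fK//; lra.
have p_bd t : -1 < t -> exists M, forall y, `|p y t - p y 0| <= M * `|y|.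
  move=> t1.
  have [a [b [ab a1 hab]]] : exists a b, [/\ a <= b, -1 < a &
      forall y, `|p y t - p y 0| = `|p y b - p y a|].
    have [t0|t0] := leP 0 t; first by exists 0, t; split => //; lra.
    by exists t, 0; split => // [|y]; [exact: ltW | rewrite distrC].
  have [c _ hc] := @EVT_max _ (fun s => `|f s|) a b ab
    (continuous_subspaceT (fun s => continuous_comp (@fc s) (@norm_continuous _
      _ _))).
  exists (`|f c| * (b - a)) => y; rewrite hab.
  have := p_near y 0 a b `|f c| a1 ab.
  rewrite -(scale0r 0) ipZl !mul0r mulr0 subr0; apply => r ar rb.
  by rewrite scale0r subr0; apply: hc; rewrite in_itv/= ar.
(* Subtracting [p y 0] moves the base point from -1 to 0. For [t <= -1] the value 0 is a
   placeholder. *)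
have G_ex t : exists z, (-1 < t) -> forall y, ip z y = p y t - p y 0.
  have [t1|] := ltP (-1) t; last by exists 0.
  have [||z hz] := @riesz_representation _ _ _ ip_norm (fun y => p y t - p y 0).
  - by move=> a x y; rewrite !p_lin; lra.
  - exact: p_bd.
  - by exists z.
have [G GP] := choice G_ex.
exists G.
  apply/eqP; rewrite -normr_eq0 -sqrf_eq0 -ip_norm GP ?subrr//; lra.
move=> t t1; apply: near_is_derive => e e0.
have /cvgrPdist_le/(_ _ e0)[d /= d0 hd] := fc t.
near=> s.
have s1 : -1 < s by near: s; apply: lt_nbhsr.
have sd : `|t - s| < d by near: s; exists d.
(* Testing the weak estimate against the remainder [y] itself, then dividing by [|y|], turns it into
   a norm estimate. *)
set y := G s - G t - _.
have hy : `|ip y y| <= e * `|s - t| * `|y|.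
  have -> : ip y y = p y s - p y t - (s - t) * ip (f t) y.
    by rewrite {1}/y !ipBl ipZl !GP//; lra.
  have [ts|st] := leP t s.
    rewrite (ger0_norm (_ : 0 <= s - t)) ?subr_ge0//;
      apply: p_near => // r tr rs.
    rewrite distrC; apply: hd; rewrite /ball_/= ler0_norm; last lra.
    by rewrite ler0_norm in sd; lra.
  rewrite -[leLHS]normrN (ltr0_norm (_ : s - t < 0)) ?subr_lt0//.
  have -> : - (p y s - p y t - (s - t) * ip (f t) y) =
    p y t - p y s - (t - s) * ip (f t) y by lra.
  rewrite opprB; apply: p_near => //; first exact: ltW.
  move=> r sr rt; rewrite distrC; apply: hd; rewrite /ball_/= ger0_norm;
    last lra.
  by rewrite gtr0_norm in sd; lra.
rewrite ip_norm ger0_norm ?sqr_ge0// expr2 in hy.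
have [->|y0] := eqVneq y 0; first by rewrite normr0 mulr_ge0// ltW.
by rewrite -(ler_pM2r (_ : 0 < `|y|)) ?normr_gt0.
Unshelve. all: by end_near.
Qed.

End primitive.

(** * Picard iteration *)

Section clamp.
Context (R : realType) (T : R).
Hypothesis T_ge0 : 0 <= T.

(** The projection onto [[0, T]]; composition with it extends data from [[0, T]] to the whole line,
    so that continuity can be asked everywhere. *)
Definition clamp (t : R) : R := Num.max 0 (Num.min t T).

Lemma clamp_ge0 t : 0 <= clamp t.
Proof. by rewrite le_max lexx. Qed.

Lemma clamp_le t : clamp t <= T.
Proof. by rewrite ge_max T_ge0 ge_min lexx orbT. Qed.

Lemma clamp_itv t : clamp t \in `[0, T].
Proof. by rewrite in_itv/= clamp_ge0 clamp_le. Qed.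

Lemma clamp_id t : 0 <= t -> t <= T -> clamp t = t.
Proof. by move=> t0 tT; rewrite /clamp (min_idPl tT) (max_idPr t0). Qed.

Lemma clamp_lipschitz s t : `|clamp s - clamp t| <= `|s - t|.
Proof.
wlog st : s t / s <= t.
  by move=> h; have [/h//|/ltW/h] := leP s t; rewrite distrC (distrC t).
rewrite distrC (distrC s) [leRHS]ger0_norm ?subr_ge0// /clamp.
have := T_ge0; rewrite ler_norml /Order.max /Order.min.
by do 4 case: ifPn; rewrite -?leNgt => *; apply/andP; split; lra.
Qed.

Lemma clamp_continuous : continuous clamp.
Proof.
move=> t; apply/cvgrPdist_lt => e e0; exists e => // s /= st.
exact: le_lt_trans (clamp_lipschitz _ _) st.
Qed.

End clamp.

Section picard.
Context (R : realType) (H : completeNormedModType R).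
Context (ip : {dot H for (@idfun R)}).
Hypothesis ip_norm : forall x : H, ip x x = `|x| ^+ 2.
Context (F : R -> H -> H) (L T : R) (u0 : H).
Hypotheses (L_ge0 : 0 <= L) (T_ge0 : 0 <= T)
  (F_lipschitz : forall t u w, `|F t u - F t w| <= L * `|u - w|)
  (F_continuous : forall u, continuous (F ^~ u)).
Local Notation c := (clamp T).

Lemma continuous_nemytskii (w : R -> H) : continuous w ->
  continuous (fun s => F s (w s)).
Proof.
move=> wc t; apply/cvgrPdist_le => e e0.
have e2 : 0 < e / 2 by lra.
have L1 : 0 < L + 1 by have := L_ge0; lra.
have eL : 0 < e / 2 / (L + 1) by rewrite divr_gt0.
near=> s.
have h1 : `|w t - w s| <= e / 2 / (L + 1).
  by near: s; have /cvgrPdist_le/(_ _ eL) := wc t.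
have h2 : `|F t (w t) - F s (w t)| <= e / 2.
  by near: s; have /cvgrPdist_le/(_ _ e2) := @F_continuous (w t) t.
rewrite -(subrKA (F s (w t))); apply: le_trans (ler_normD _ _) _.
have h3 := le_trans (F_lipschitz s _ _) (ler_wpM2l L_ge0 h1).
suff : L * (e / 2 / (L + 1)) <= e / 2 by lra.
by rewrite mulrCA ger_pMr// ler_pdivrMr//; lra.
Unshelve. all: by end_near.
Qed.

(** Clamping the argument of [w] makes the new iterate differentiable beyond both ends of [[0, T]],
    hence two-sidedly at 0 and [T]. *)
Lemma picard_step (w : R -> H) : continuous (w \o c) ->
  exists w' : R -> H, w' 0 = u0 /\
    forall t : R, -1 < t -> is_derive t (1 : R) w' (F t (w (c t))).
Proof.
move=> /continuous_nemytskii/(continuous_primitive ip_norm)[G G0 GP].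
exists (cst u0 + G); split; first by rewrite !fctE G0 addr0.
move=> t /GP Gt; rewrite -[F _ _]add0r.
exact: is_deriveD.
Qed.

Lemma derive_clamp_continuous (w w' : R -> H) :
  (forall t : R, -1 < t -> is_derive t (1 : R) w (w' t)) ->
  continuous (w \o c).
Proof.
move=> wP t; apply: continuous_comp; first exact: clamp_continuous.
apply: (@is_derive_continuous _ _ _ _ (w' (c t))).
by apply: wP; apply: lt_le_trans (clamp_ge0 _ _); lra.
Qed.

Lemma picard_lindelof : exists u : R -> H,
  u 0 = u0 /\
  forall t : R, 0 <= t -> t <= T -> is_derive t (1 : R) u (F t (u t)).
Proof.
(* The step is made total for the sake of choice; the value at a discontinuous [w] is arbitrary. *)
have stepP (w : R -> H) : exists w' : R -> H, continuous (w \o c) ->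
   w' 0 = u0 /\ forall t : R, -1 < t -> is_derive t (1 : R) w' (F t (w (c t))).
  have [/picard_step[w' w'P]|nc] := pselect (continuous (w \o c)).
    by exists w'.
  by exists w.
have [step {}stepP] := choice stepP.
pose u n := iter n step (cst u0).
have u_cont n : continuous (u n \o c).
  elim: n => [|n IH]; first exact: cst_continuous.
  have [_ h] := stepP _ IH; exact: derive_clamp_continuous h.
have u_zero n : u n 0 = u0 by case: n => // n; exact: (stepP _ (u_cont n)).1.
have u_derive n (t : R) : -1 < t -> is_derive t (1 : R) (u n.+1) (F t (u n (c
  t))).
  by apply: (stepP _ (u_cont n)).2.
have [K K0 KP] : exists2 K, 0 <= K & forall t, 0 <= t -> t <=
  T -> `|u 1%N t - u 0%N t| <= K.
  have nc : continuous (fun t => `|u 1%N (c t) - u 0%N (c t)|).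
    move=> t; have h : {for t, continuous ((u 1%N \o c) - (u 0%N \o c))}.
      by apply: continuousB; exact: u_cont.
    exact: (continuous_comp h (@norm_continuous _ _ _)).
  have [b _ hb] := EVT_max T_ge0 (continuous_subspaceT nc).
  exists `|u 1%N (c b) - u 0%N (c b)| => // t t0 tT.
  by have := hb t; rewrite in_itv/= t0 tT (clamp_id t0)//; apply.
(* With the weight E (Bielecki), the Picard operator is a 1/2-contraction on the
   whole of [0, T], however large T is. *)
pose E t := expR (2 * L * t).
have E_gt0 t : 0 < E t by exact: expR_gt0.
(* The tangent inequality [1 + x <= exp x], in the increment form that [mean_value_inequality] asks
   of [phi]. *)
have E_incr t s : E t * (2 * L * (s - t)) <= E s - E t.
  have -> : E s = E t * expR (2 * L * (s - t)).
    by rewrite /E -expRD; congr expR; lra.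
  have h := expR_ge1Dx (2 * L * (s - t)).
  rewrite -[X in _ <= _ - X]mulr1 -mulrBr ler_pM2l//; lra.
have u_diff n t : 0 <= t -> t <= T -> `|u n.+1 t - u n t| <= K / 2 ^+ n * E t.
  elim: n t => [|n IH] t t0 tT.
    rewrite expr0 divr1; apply: le_trans (KP _ t0 tT) _.
    rewrite ler_peMr//; apply: le_trans (expR_ge1Dx _).
    by rewrite lerDl mulr_ge0// mulr_ge0.
  have q0 : 0 <= K / 2 ^+ n by rewrite divr_ge0// exprn_ge0.
  have Kn : K / 2 ^+ n.+1 = 2^-1 * (K / 2 ^+ n).
    by rewrite exprS invfM mulrCA.
  have := @mean_value_inequality _ _ (u n.+2 - u n.+1)
     (fun t => F t (u n.+1 (c t)) - F t (u n (c t)))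
     (fun t => K / 2 ^+ n.+1 * E t) 0 t t0.
  rewrite !fctE !u_zero subrr subr0 => h.
  apply: le_trans (h _ _) _.
  - by move=> s s0 _; apply: is_deriveB; apply: u_derive; lra.
  - move=> r s r0 rs st; rewrite clamp_id//; last lra.
    have rT : r <= T by lra.
    have h1 := le_trans (F_lipschitz r _ _) (ler_wpM2l L_ge0 (IH r r0 rT)).
    have sr0 : 0 <= s - r by lra.
    apply: le_trans (ler_wpM2r sr0 h1) _.
    rewrite -mulrBr Kn; have := ler_wpM2l q0 (E_incr r s); lra.
  - rewrite gerBl; apply: mulr_ge0; [|exact: ltW].
    by rewrite divr_ge0// exprn_ge0.
have E_le t : t <= T -> E t <= E T.
  by move=> tT; rewrite ler_expR ler_wpM2l// mulr_ge0.
(* Bounding the weight by [E T] turns the weighted estimate into a uniform geometric one. *)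
pose K' := K * E T.
have K'0 : 0 <= K' by rewrite mulr_ge0// ltW.
have v_ex t : exists l, forall n, `|l - u n (c t)| <= 2 * K' / 2 ^+ n.
  apply: geometric_cvg => n;
    apply: le_trans (u_diff _ _ (clamp_ge0 _ _) (clamp_le T_ge0 _)) _.
  rewrite /K' mulrAC ler_wpM2r ?invr_ge0 ?exprn_ge0// ler_wpM2l// E_le//.
  exact: clamp_le.
have [v vP] := choice v_ex.
have v_cont : continuous v.
  move=> t; apply/cvgrPdist_le => e e0.
  have e3 : 0 < e / 3 by lra.
  have [N hN] := geometric_lt (2 * K') e3.
  have /cvgrPdist_le/(_ _ e3) := @u_cont N t; apply: filterS => s /= hs.
  have h1 := vP t N; have h2 := vP s N; rewrite distrC in h2.
  rewrite -(subrKA (u N (c t))) -(subrKA (u N (c s)) (u N (c t))).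
  have n1 := ler_normD (v t - u N (c t)) (u N (c t) - u N (c s) + (u N (c s) -
    v s)).
  have n2 := ler_normD (u N (c t) - u N (c s)) (u N (c s) - v s).
  lra.
(* The limit [v] is not differentiated: [w] is defined as [u0] plus the primitive of [F s (v s)],
   and [w = v] on [[0, T]] follows by comparing both with the iterate [u n.+1]. *)
have [G G0 GP] := continuous_primitive ip_norm (continuous_nemytskii v_cont).
pose w : R -> H := cst u0 + G.
have w_derive (t : R) : -1 < t -> is_derive t (1 : R) w (F t (v t)).
  by move=> /GP Gt; rewrite -[F _ _]add0r; apply: is_deriveD.
have w0 : w 0 = u0 by rewrite /w !fctE G0 addr0.
have w_v t : 0 <= t -> t <= T -> w t = v t.
  move=> t0 tT; apply/eqP; rewrite -subr_eq0 -normr_le0.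
  apply: (@le_geometric _ _ _ (L * (2 * K') * T + 2 * K')) => n; rewrite add0r.
  have := @mean_value_inequality _ _ (w - u n.+1)
     (fun t => F t (v t) - F t (u n (c t)))
     (fun t => L * (2 * K' / 2 ^+ n) * t) 0 t t0.
  rewrite !fctE w0 u_zero subrr subr0 => h.
  have {}h : `|w t - u n.+1 t| <= L * (2 * K' / 2 ^+ n) * T.
    apply: le_trans (h _ _) _.
    - by move=> s s0 _; apply: is_deriveB; [apply: w_derive;
      lra | apply: u_derive; lra].
    - move=> r s r0 rs st; rewrite -mulrBr ler_wpM2r ?subr_ge0//.
      apply: le_trans (F_lipschitz _ _ _) _.
      by apply: ler_wpM2l => //; exact: vP.
    - rewrite mulr0 subr0 ler_wpM2l// mulr_ge0// divr_ge0 ?exprn_ge0//.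
      by rewrite mulr_ge0.
  have h1 := vP t n.+1; rewrite clamp_id// distrC in h1.
  have h2 : 2 * K' / 2 ^+ n.+1 <= 2 * K' / 2 ^+ n.
    apply: ler_wpM2l; first exact: mulr_ge0.
    by rewrite lef_pV2 ?posrE ?exprn_gt0// ler_eXn2l// ltr1n.
  rewrite -(subrKA (u n.+1 t)); apply: le_trans (ler_normD _ _) _.
  lra.
exists w; split => // t t0 tT; rewrite w_v//; apply: w_derive; lra.
Qed.

End picard.

(** * The sweeping process *)

(** Families consisting of a single interval. *)
Lemma absolutely_continuous_unif (R : realType) (a b : R) (f : R -> R) :
  absolutely_continuous a b f -> forall e, 0 < e -> exists2 d, 0 < d &
    forall s t, s \in `[a, b] -> t \in `[a, b] -> `|s - t| < d ->
      `|f s - f t| < e.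
Proof.
move=> f_ac e /f_ac[d d0 hd]; exists d => // s t.
wlog st : s t / s <= t.
  move=> h; have [/h//|/ltW/h {}h] := leP s t => sab tab.
  by rewrite distrC (distrC (f s)); exact: h.
rewrite !in_itv/= => /andP[as_ _] /andP[_ tb].
rewrite distrC ger0_norm ?subr_ge0// distrC => std.
have := hd 1%N (fun=> s) (fun=> t); rewrite !big_ord1; apply => //.
by move=> i j _ _ _; rewrite !ord1.
Qed.

Section sweeping.
Context (R : realType) (H : completeNormedModType R).
Context (ip : {dot H for (@idfun R)}).
Hypothesis ip_norm : forall x : H, ip x x = `|x| ^+ 2.
Context (T : R) (A B : {linear H -> H}) (beta : R) (C : R -> set H).
Hypotheses (T_gt0 : 0 < T) (B_bounded : bounded_operator B)
  (beta_gt0 : 0 < beta)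
  (A_coercive : forall x : H, beta * `|x| ^+ 2 <= ip (A x) x).
Local Notation c := (clamp T).

Lemma velocity_continuous (v : R -> R) (Y : R -> H) (u : H) :
  absolutely_continuous 0 T v ->
  (forall s t : R, 0 <= s -> s <= t -> t <= T ->
    (hausdorff_dist (C t) (C s) <= (v t - v s)%:E)%E) ->
  (forall t, velocity_spec ip A B (C (c t)) u (Y t)) ->
  continuous Y.
Proof.
move=> v_ac C_v YP t; apply/cvgrPdist_le => e e0.
pose a := `|Y t|.
have a0 : 0 <= a by exact: normr_ge0.
have a2e : 0 < 2 * a + e by lra.
(* With [x = |Y t - Y s|] and [q] the variation of [v], [velocity_holder] yields
   [beta x^2 <= (2 a + x) q]. As [x^2 / (2 a + x)] increases with [x], a value of [q] below this
   threshold forces [x <= e]. *)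
have d0 : 0 < beta * e ^+ 2 / (2 * a + e).
  by rewrite divr_gt0// mulr_gt0// exprn_gt0.
have [d dpos hd] := absolutely_continuous_unif v_ac d0.
exists d => // s /= st.
have cst_ : `|c s - c t| < d.
  by rewrite distrC; apply: le_lt_trans st; apply: clamp_lipschitz; exact: ltW.
have T0 := ltW T_gt0.
have vst := hd _ _ (clamp_itv T0 s) (clamp_itv T0 t) cst_.
have h : (hausdorff_dist (C (c t)) (C (c s)) <= `|v (c s) - v (c t)|%:E)%E.
  have [cts|/ltW cts] := leP (c s) (c t).
    apply: le_trans (C_v _ _ (clamp_ge0 T s) cts (clamp_le T0 t)) _.
    by rewrite lee_fin distrC ler_norm.
  rewrite hausdorff_distC.
  apply: le_trans (C_v _ _ (clamp_ge0 T t) cts (clamp_le T0 s)) _.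
  by rewrite lee_fin ler_norm.
have := velocity_holder ip_norm A_coercive h (YP t) (YP s).
have := ler_normB (Y t) (Y t - Y s); rewrite opprB addrC subrK -/a.
move: (`|v _ - v _|) (normr_ge0 (v (c s) - v (c t))) vst => q q0 vst.
move: (`|Y t - Y s|) (normr_ge0 (Y t - Y s)) => x x0 Ysx hx.
rewrite leNgt; apply/negP => ex.
have h1 : beta * x ^+ 2 <= (2 * a + x) * q.
  by apply: le_trans hx _; rewrite ler_wpM2r//; lra.
have h2 : e * (2 * a + x) <= x * (2 * a + e) by nra.
move: vst; rewrite ltr_pdivlMr// => vst.
have h3 : e * (beta * x ^+ 2) <= x * (beta * e ^+ 2).
  apply: le_trans (ler_wpM2l (ltW e0) h1) _.
  rewrite mulrA; apply: le_trans (ler_wpM2r q0 h2) _.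
  by rewrite -mulrA ler_wpM2l// mulrC ltW.
have : x <= e.
  have p0 : 0 < beta * e * x by rewrite !mulr_gt0//; lra.
  by rewrite -(ler_pM2l p0); lra.
by rewrite leNgt ex.
Qed.

Lemma lipschitz_itvP (u : R -> H) : [lipschitz u t | t in `[0, T]] ->
  exists2 K, 0 <= K & forall s t, s \in `[0, T] -> t \in `[0, T] ->
    `|u s - u t| <= K * `|s - t|.
Proof.
(* The bound is available for constants strictly above [K], hence the [+ 1]. *)
move=> [K [_ hK]]; exists (Num.max K 0 + 1) => [|s t sI tI].
  by rewrite addr_ge0// le_max lexx orbT.
have K_lt : K < Num.max K 0 + 1.
  by apply: (@le_lt_trans _ _ (Num.max K 0)); rewrite ?le_max ?lexx// ltrDl.
exact: (hK _ K_lt (s, t) (conj sI tI)).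
Qed.

(** Uniqueness of the velocity turns the inclusion into the equation [w' = Y t w] off a null set. *)
Lemma sweeping_solution_derive (Y : R -> H -> H) (u0 : H) (w : R -> H) :
  (forall t u, velocity_spec ip A B (C (c t)) u (Y t u)) ->
  sweeping_solution ip T A B C u0 w ->
  exists2 N, (@lebesgue_measure R).-negligible N & forall t : R,
    0 <= t -> t <= T -> ~ N t -> is_derive t (1 : R) w (Y t (w t)).
Proof.
move=> YP [_ w_ae _]; exists (~` [set t | t \in `[0, T] -> derivable w t 1 /\
   normal_cone ip (C t) (A (derive1 w t) + B (w t)) (- derive1 w t)]).
  exact: w_ae.
move=> t t0 tT /contrapT/=;
  rewrite in_itv/= t0 tT => /(_ isT)[wt /normal_coneP h].
apply: DeriveDef => //; rewrite -derive1E.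
have := YP t (w t); rewrite clamp_id// => h'.
exact: (velocity_unique ip_norm beta_gt0 A_coercive B_bounded h h').
Qed.

Lemma sweeping_solution_unique (Y : R -> H -> H) (L : R) (u0 : H) (u w : R ->
  H) :
  0 <= L ->
  (forall t u, velocity_spec ip A B (C (c t)) u (Y t u)) ->
  (forall t u w, `|Y t u - Y t w| <= L * `|u - w|) ->
  sweeping_solution ip T A B C u0 u ->
  sweeping_solution ip T A B C u0 w ->
  {in `[0, T], w =1 u}.
Proof.
move=> L0 YP Y_lip u_sol w_sol t; rewrite in_itv/= => /andP[t0 tT].
have [N N0 hu] := sweeping_solution_derive YP u_sol.
have [N' N'0 hw] := sweeping_solution_derive YP w_sol.
have [u_lip _ u_init] := u_sol; have [w_lip _ w_init] := w_sol.
have [Ku Ku0 KuP] := lipschitz_itvP u_lip.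
have [Kw Kw0 KwP] := lipschitz_itvP w_lip.
pose D : R -> H := w - u.
pose E s := expR (- L * s).
have E_ge0 s : 0 <= E s by exact: ltW (expR_gt0 _).
have E_le1 s : 0 <= s -> E s <= 1.
  by move=> s0; rewrite /E -expR0 ler_expR mulNr oppr_le0 mulr_ge0.
have E_decr r s : E s * (1 + L * (s - r)) <= E r.
  have -> : E r = E s * expR (L * (s - r)) by rewrite /E -expRD; congr expR;
    lra.
  by rewrite ler_wpM2l// expR_ge1Dx.
pose f s := `|D s| * E s.
suff : f t <= f 0.
  rewrite /f /D !fctE w_init u_init subrr normr0 mul0r.
  by rewrite pmulr_lle0 ?expR_gt0// normr_le0 subr_eq0 => /eqP.
apply: (@ae_right_nonincreasing _ f 0 t (Kw + Ku) (N `|` N')) => //.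
- exact: addr_ge0.
(* The increment of [f] is [E s (|D s| - |D r|) + |D r| (E s - E r)]: the second term is
   nonpositive, and [E s <= 1] bounds the first. *)
- move=> r s r0 rs st.
  have rI : r \in `[0, T] by rewrite in_itv/=; lra.
  have sI : s \in `[0, T] by rewrite in_itv/=; lra.
  have h1 := KwP _ _ sI rI; have h2 := KuP _ _ sI rI.
  rewrite (ger0_norm (_ : 0 <= s - r)) ?subr_ge0// in h1 h2.
  have h3 : `|D s - D r| <= (Kw + Ku) * (s - r).
    have -> : D s - D r = (w s - w r) - (u s - u r).
      have DE x : D x = w x - u x by [].
      by rewrite !DE !opprB (addrC (u r)) addrACA (addrC (- u s)).
    by apply: le_trans (ler_normB _ _) _; rewrite mulrDl lerD.
  have h4 : `|D s| - `|D r| <= `|D s - D r| by exact: lerB_dist.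
  have h5 : E s <= E r.
    apply: le_trans (E_decr r s); rewrite ler_peMr// lerDl mulr_ge0//.
    by rewrite subr_ge0.
  have s0 : 0 <= s by lra.
  have h6 : E s * (`|D s| - `|D r|) <= (Kw + Ku) * (s - r).
    have [neg|/ltW pos] := leP (`|D s| - `|D r|) 0.
      apply: (@le_trans _ _ 0); first by rewrite mulr_ge0_le0.
      by apply: mulr_ge0; [exact: addr_ge0 | rewrite subr_ge0].
    apply: le_trans (ler_wpM2r pos (E_le1 s s0)) _; lra.
  have := ler_wpM2l (normr_ge0 (D r)) h5; rewrite /f; lra.
- exact: negligibleU.
(* Here [|D s|] is at most [|D r| (1 + L (s - r)) + e (s - r)], and the factor [1 + L (s - r)] is
   absorbed by the decay of [E]. *)
- move=> r r0 rt /not_orP[Nr N'r] e e0.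
  have rT : r <= T by lra.
  have Dr : is_derive r (1 : R) D (Y r (w r) - Y r (u r)).
    by apply: is_deriveB; [exact: hw | exact: hu].
  have hY := Y_lip r (w r) (u r).
  near=> s.
  have rs : r < s by near: s; exact: nbhs_right_gt.
  have hs : `|D s - D r| <= `|Y r (w r) - Y r (u r)| * (s - r) + e * (s - r).
    by near: s; exact: is_derive_near_right.
  have sr : 0 <= s - r by lra.
  have h1 : `|D s| - `|D r| <= (L * `|D r| + e) * (s - r).
    apply: le_trans (lerB_dist _ _) (le_trans hs _).
    by rewrite -mulrDl ler_wpM2r// lerD2r.
  have h2 := ler_wpM2l (E_ge0 s) h1.
  have h3 := ler_wpM2l (normr_ge0 (D r)) (E_decr r s).
  have s0 : 0 <= s by lra.
  have h4 := ler_wpM2r (mulr_ge0 (ltW e0) sr) (E_le1 s s0).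
  rewrite /f; lra.
Unshelve. all: by end_near.
Qed.

End sweeping.
Unset Implicit Arguments.

Theorem theorem3p1 (R : realType) (H : completeNormedModType R)
    (ip : {dot H for (@idfun R)})
    (ip_norm : forall x : H, ip x x = `|x| ^+ 2)
    (H_separable : separable_space H)
    (T : R) (T_gt0 : 0 < T)
    (A B : {linear H -> H})
    (A_bounded : bounded_operator A) (B_bounded : bounded_operator B)
    (A_symmetric : symmetric_operator ip A)
    (B_symmetric : symmetric_operator ip B)
    (beta : R) (beta_gt0 : 0 < beta)
    (A_coercive : forall x : H, beta * `|x| ^+ 2 <= ip (A x) x)
    (B_nonneg : forall x : H, 0 <= ip (B x) x)
    (C : R -> set H)
    (C_nonempty : forall t, t \in `[0, T] -> C t !=set0)
    (C_closed : forall t, t \in `[0, T] -> closed (C t))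
    (C_convex : forall t, t \in `[0, T] -> convex_set (C t))
    (C_moving : exists v : R -> R,
       [/\ forall t, t \in `[0, T] -> 0 <= v t,
           {in `[0, T] &, nondecreasing_fun v},
           absolutely_continuous 0 T v,
           v 0 = 0 &
           forall s t : R, 0 <= s -> s <= t -> t <= T ->
             (hausdorff_dist (C t) (C s) <= (v t - v s)%:E)%E])
    (u0 : H) (u0_init : C 0 (B u0)) :
  exists2 u : R -> H,
    sweeping_solution ip T A B C u0 u &
    forall w : R -> H, sweeping_solution ip T A B C u0 w ->
      {in `[0, T], w =1 u}.

Proof.
have [M M0 BM] := bounded_operator_ge0 B_bounded.
have [v [_ _ v_ac _ C_v]] := C_moving.
have T_ge0 := ltW T_gt0.
(* Clamping the time defines the velocity for every real [t], as the global Picard theorem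
   requires. *)
have Y_ex (p : R * H) : exists y, velocity_spec ip A B (C (clamp T p.1)) p.2 y.
  have tI := clamp_itv T_ge0 p.1.
  by apply: (velocity_exists ip_norm B beta_gt0 A_bounded A_symmetric
    A_coercive);
    [exact: C_closed | exact: C_nonempty | exact: C_convex].
have [Y' Y'P] := choice Y_ex.
pose Y t u := Y' (t, u).
have YP t u : velocity_spec ip A B (C (clamp T t)) u (Y t u)
  by exact: (Y'P (t, u)).
pose L := M / beta.
have L0 : 0 <= L by rewrite divr_ge0// ltW.
have Y_lip t u w : `|Y t u - Y t w| <= L * `|u - w|.
  have := velocity_lipschitz ip_norm A_coercive BM (YP t u) (YP t w).
  by rewrite /L mulrAC ler_pdivlMr// mulrC.
have Y_cont u : continuous (Y ^~ u).
  by apply: (velocity_continuous ip_norm T_gt0 beta_gt0 A_coercive v_ac C_v) =>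
    t; exact: YP.
have [u [u_init u_derive]] := picard_lindelof ip_norm u0 L0 T_ge0 Y_lip Y_cont.
have u_sol : sweeping_solution ip T A B C u0 u.
  split => //.
    (* The Lipschitz constant is the maximum over [[0, T]] of the speed [|Y t (u t)|], written with
       clamped arguments so as to be continuous on the line. *)
    have u_clamp : continuous (u \o clamp T).
      move=> t; apply: continuous_comp; first exact: clamp_continuous.
      exact: is_derive_continuous (u_derive _ (clamp_ge0 _ _) (clamp_le T_ge0
        _)).
    have Y_u := continuous_nemytskii L0 Y_lip Y_cont u_clamp.
    have nc : continuous (fun t => `|Y t (u (clamp T t))|).
      by move=> t; exact: (continuous_comp (@Y_u t) (@norm_continuous _ _ _)).
    have [b _ hb] := EVT_max T_ge0 (continuous_subspaceT nc).
    exists `|Y b (u (clamp T b))|; split => [|K /ltW YK [s t] /= []].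
      exact: normr_real.
    suff h : s \in `[0, T] -> t \in `[0, T] ->
        `|u s - u t| <= `|Y b (u (clamp T b))| * `|s - t|.
      by move=> sI tI; apply: le_trans (h sI tI) _; rewrite ler_wpM2r.
    wlog st : s t / s <= t.
      move=> h; have [/h//|/ltW/h {}h] := leP s t => sI tI.
      by rewrite distrC (distrC s); exact: h.
    rewrite /= !in_itv/= => /andP[s0 _] /andP[_ tT].
    rewrite distrC (distrC s) (ger0_norm (_ : 0 <= t - s)) ?subr_ge0//.
    rewrite mulrBr; apply: (@mean_value_inequality _ _ u (fun t => Y t (u t))
      (fun r => `|Y b (u (clamp T b))| * r)) => //.
    - by move=> r sr rt; apply: u_derive; lra.
    - move=> r q sr rq qt; rewrite -mulrBr ler_wpM2r ?subr_ge0//.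
      have r0 : 0 <= r by lra.
      have rT : r <= T by lra.
      by have := hb r; rewrite in_itv/= r0 rT clamp_id//; apply.
  (* The equation holds at every [t] in [[0, T]], endpoints included. *)
  apply: aeW => t; rewrite in_itv/= => /andP[t0 tT].
  have ut := u_derive t t0 tT; split; first exact: ex_derive.
  apply/normal_coneP; have := YP t (u t); rewrite clamp_id//.
  by rewrite derive1E derive_val.
exists u => // w w_sol.
exact: (sweeping_solution_unique ip_norm B_bounded beta_gt0 A_coercive L0 YP
  Y_lip u_sol w_sol).
Qed.
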